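(* Let $M_1$ and $M_2$ be two $\Gamma$-semigroups, let $T: M_1 \to \mathcal{P}^*(M_2)$ be a set-valued anti-homomorphism, and let $B$ be a bi-quasi-interior ideal of $M_2$. Then: (i) $\overline{T}(B)$ is a bi-quasi-interior ideal of $M_1$, if $T(x)\neq\emptyset$ for all $x\in M_1$ and $\overline{T}(B)\neq\emptyset$; (ii) $\underline{T}(B)$ is a bi-quasi-interior ideal of $M_1$, if $\underline{T}(B)\neq\emptyset$ and $T$ is a strong set-valued anti-homomorphism.
   Context: For non-empty sets $M$ and $\Gamma$, $M$ is a $\Gamma$-semigroup if there is a map $M\times\Gamma\times M\to M$, $(a,\alpha,b)\mapsto a\alpha b$, with $(a\alpha b)\beta c = a\alpha(b\beta c)$ for all $a,b,c\in M$, $\alpha,\beta\in\Gamma$. Both $M_1$ and $M_2$ are $\Gamma$-semigroups for the same set $\Gamma$. For subsets $A,B$ of a $\Gamma$-semigroup and $\alpha\in\Gamma$, $A\alpha B=\{a\alpha b : a\in A, b\in B\}$ and $A\Gamma B=\{a\gamma b : a\in A, b\in B,\gamma\in\Gamma\}$. $\mathcal{P}^*(M_2)$ is the set of all non-empty subsets of $M_2$. A map $T:M_1\to\mathcal{P}^*(M_2)$ is a set-valued anti-homomorphism if $T(a\alpha b)\supseteq T(b)\alpha T(a)$ for all $a,b\in M_1$, $\alpha\in\Gamma$; it is a strong set-valued anti-homomorphism if $T(a\alpha b)=T(b)\alpha T(a)$ for all $a,b\in M_1$, $\alpha\in\Gamma$. For $G\subseteq M_2$, $\underline{T}(G)=\{x\in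 M_1 : T(x)\subseteq G\}$ and $\overline{T}(G)=\{x\in M_1 : T(x)\cap G\neq\emptyset\}$. A non-empty subset $S$ of a $\Gamma$-semigroup $M$ is a sub-$\Gamma$-semigroup of $M$ if $S\Gamma S\subseteq S$. A non-empty subset $B$ of $M$ is a bi-quasi-interior ideal of $M$ if $B$ is a sub-$\Gamma$-semigroup of $M$ and $B\Gamma M\Gamma B\Gamma M\Gamma B\subseteq B$. *)

(* Defs.v *)
From mathcomp Require Import all_boot.
From mathcomp Require Import boolp classical_sets.

Set Implicit Arguments.
Unset Strict Implicit.
Unset Printing Implicit Defensive.

Local Open Scope classical_set_scope.

Record gammaSemigroup (Gamma : Type) := GammaSemigroup {
  carrier :> Type;
  gmul : carrier -> Gamma -> carrier -> carrier;
  gmulA : forall (a b c : carrier) (alpha beta : Gamma),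
    gmul (gmul a alpha b) beta c = gmul a alpha (gmul b beta c);
  carrier_inhabited : inhabited carrier;
  gamma_inhabited : inhabited Gamma }.

Record nonemptySubset (M : Type) := NonemptySubset {
  subset_of :> set M;
  subset_of_neq0 : subset_of !=set0 }.

Section GammaSubsets.
Variables (Gamma : Type) (M : gammaSemigroup Gamma).
Implicit Types (A B S : set M) (alpha : Gamma).

Definition gmul_at A alpha B : set M := [set gmul a alpha b | a in A & b in B].

Definition gmul_all A B : set M := \bigcup_gamma gmul_at A gamma B.

Definition sub_gamma_semigroup S := S !=set0 /\ gmul_all S S `<=` S.

(* By gmulA, the bracketing of the fivefold product is immaterial. *)
Definition bi_quasi_interior_ideal B :=
  sub_gamma_semigroup B /\
  gmul_all (gmul_all (gmul_all (gmul_all B setT) B) setT) B `<=` B.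

End GammaSubsets.

Section SetValued.
Variables (Gamma : Type) (M1 M2 : gammaSemigroup Gamma).
Implicit Types (T : M1 -> nonemptySubset M2) (G : set M2).

Definition set_valued_antihom T :=
  forall (a b : M1) (alpha : Gamma),
    gmul_at (T b) alpha (T a) `<=` T (gmul a alpha b).

Definition strong_set_valued_antihom T :=
  forall (a b : M1) (alpha : Gamma),
    T (gmul a alpha b) = gmul_at (T b) alpha (T a) :> set M2.

Definition lower_approx T G : set M1 := [set x | T x `<=` G].

Definition upper_approx T G : set M1 := [set x | T x `&` G !=set0].

End SetValued.

(* Main.v *)
(** An anti-homomorphism reverses the fivefold product
    [b1 m1 b2 m2 b3]; since the pattern [B M B M B] is a palindrome, the
    reversed product, rebracketed by associativity, again lies in [B]. *)
Require Import Defs.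
From mathcomp Require Import all_boot.
From mathcomp Require Import boolp classical_sets.

Local Open Scope classical_set_scope.

Lemma mem_gmul_all (Gamma : Type) (M : gammaSemigroup Gamma)
    (A B : set M) (a b : M) (alpha : Gamma) :
  A a -> B b -> gmul_all A B (gmul a alpha b).
Proof. by move=> Aa Bb; exists alpha => //; exists a => //; exists b. Qed.

Lemma gmul_all_subsetP (Gamma : Type) (M : gammaSemigroup Gamma)
    (A B C : set M) :
  gmul_all A B `<=` C <->
  forall a alpha b, A a -> B b -> C (gmul a alpha b).
Proof.
split=> [sABC a alpha b Aa Bb | sABC _ [alpha _ [a Aa [b Bb <-]]]].
  exact/sABC/mem_gmul_all.
exact: sABC.
Qed.

(** Unfolding the nested [gmul_all] turns both closure conditions into statements about products of
    elements, the form in which the two approximations are checked. *)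
Lemma bi_quasi_interior_idealP (Gamma : Type) (M : gammaSemigroup Gamma)
    (B : set M) :
  bi_quasi_interior_ideal B <->
  [/\ B !=set0,
      forall a alpha b, B a -> B b -> B (gmul a alpha b) &
      forall b1 g1 m1 g2 b2 g3 m2 g4 b3, B b1 -> B b2 -> B b3 ->
        B (gmul (gmul (gmul (gmul b1 g1 m1) g2 b2) g3 m2) g4 b3)].
Proof.
split=> [[[B0 /gmul_all_subsetP BM] /gmul_all_subsetP BI] | [B0 BM BI]].
  split=> // b1 g1 m1 g2 b2 g3 m2 g4 b3 Bb1 Bb2 Bb3; apply: BI => //.
  by do 3![apply: mem_gmul_all => //].
split; first by split=> //; apply/gmul_all_subsetP.
apply/gmul_all_subsetP => _ g4 b3 [g3 _ [_ [g2 _ [_ [g1 _ [b1 Bb1 [m1 _ <-]]]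
  [b2 Bb2 <-]]] [m2 _ <-]]] Bb3.
exact: BI.
Qed.

(** Points chosen in the values of [T] at the factors, those for the [b]'s also in [B], multiply in
    reverse order to a point of both [B] and the value at the product. *)
Lemma upper_approx_bi_quasi_interior_ideal
    (Gamma : Type) (M1 M2 : gammaSemigroup Gamma)
    (T : M1 -> nonemptySubset M2) (B : set M2) :
  bi_quasi_interior_ideal B ->
  set_valued_antihom T -> upper_approx T B !=set0 ->
  bi_quasi_interior_ideal (upper_approx T B).
Proof.
move=> /bi_quasi_interior_idealP[_ BM BI] T_antihom TB0.
have TM a alpha b s t : subset_of (T a) s -> subset_of (T b) t ->
    subset_of (T (gmul a alpha b)) (gmul t alpha s).
  by move=> Tas Tbt; apply: T_antihom; exists t => //; exists s.
apply/bi_quasi_interior_idealP; split=> //.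
  move=> a alpha b [s [Tas Bs]] [t [Tbt Bt]].
  by exists (gmul t alpha s); split; [apply: TM | apply: BM].
move=> b1 g1 m1 g2 b2 g3 m2 g4 b3 [t1 [Tt1 Bt1]] [t2 [Tt2 Bt2]] [t3 [Tt3 Bt3]].
(* The factors [m1] and [m2] are arbitrary, so their values need not meet [B]; any points of these
   non-empty sets will do. *)
have [s1 Ts1] := subset_of_neq0 (T m1).
have [s2 Ts2] := subset_of_neq0 (T m2).
exists (gmul t3 g4 (gmul s2 g3 (gmul t2 g2 (gmul s1 g1 t1)))); split.
  (* Each use of [TM] moves the rightmost factor of the argument of [T] to the far left of the
     witness. *)
  by do 4![apply: (TM) => //].
by rewrite -!gmulA; apply: BI.
Qed.

(** Here every point of the value at a product must be controlled; the equality in the strong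
    condition factors each one into points of the values at the factors. *)
Lemma lower_approx_bi_quasi_interior_ideal
    (Gamma : Type) (M1 M2 : gammaSemigroup Gamma)
    (T : M1 -> nonemptySubset M2) (B : set M2) :
  bi_quasi_interior_ideal B ->
  strong_set_valued_antihom T -> lower_approx T B !=set0 ->
  bi_quasi_interior_ideal (lower_approx T B).
Proof.
move=> /bi_quasi_interior_idealP[_ BM BI] T_strong TB0.
apply/bi_quasi_interior_idealP; split=> //.
  move=> a alpha b TaB TbB y; rewrite T_strong => -[t Tbt [s Tas <-]].
  by apply: BM; [apply: TbB | apply: TaB].
move=> b1 g1 m1 g2 b2 g3 m2 g4 b3 Tb1 Tb2 Tb3 y; rewrite !T_strong.
move=> -[t3 Tt3 [_ [s2 _ [_ [t2 Tt2 [_ [s1 _ [t1 Tt1 <-]] <-]] <-]] <-]].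
(* The factorisation is right-nested; associativity brings it to the left-nested form of [BI], with
   [t3], [t2], [t1] in the three [B] positions. *)
by rewrite -!gmulA; apply: BI; [apply: Tb3 | apply: Tb2 | apply: Tb1].
Qed.

Theorem theorem5p10 (Gamma : Type) (M1 M2 : gammaSemigroup Gamma)
    (T : M1 -> nonemptySubset M2) (B : set M2)
    (T_antihom : set_valued_antihom T)
    (B_ideal : bi_quasi_interior_ideal B) :
  ((forall x : M1, T x !=set0) -> upper_approx T B !=set0 ->
     bi_quasi_interior_ideal (upper_approx T B)) /\
  (lower_approx T B !=set0 -> strong_set_valued_antihom T ->
     bi_quasi_interior_ideal (lower_approx T B)).
Proof.
split=> [_ TB0 | TB0 T_strong].
  exact: upper_approx_bi_quasi_interior_ideal.
exact: lower_approx_bi_quasi_interior_ideal.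
Qed.
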